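(* Let $G$ be a group, let $\operatorname{Conj} X$ be a subquandle of $\operatorname{Conj} G$, let $H:=\langle X\rangle\leq G$, and let $\iota:G\to G$ be the inversion map $g\mapsto g^{-1}$. Suppose that the following three conditions hold: \begin{itemize} \item $X$ is a conjugacy class of $H$. \item There exists an element $x\in X$ such that $x^2\notin Z(H)$. \item $\operatorname{Conj} X$ is inversion-closed, that is, $x^{-1}\in X$ for all $x\in X$. \end{itemize} Then $(\operatorname{Conj} X,\iota|_X)$ is a CNS-quandle.
   Context: A rack is a pair $R=(X,s)$ where $X$ is a nonempty set and $s:X\to S_X$, $x\mapsto s_x$, is a map to the symmetric group of $X$ with $s_xs_y=s_{s_x(y)}s_x$ for all $x,y\in X$. It is a quandle if $s_x(x)=x$ for all $x$, and involutory if $s_x^2=\mathrm{id}_X$ for all $x$. It is connected if the group $\langle s_x\mid x\in X\rangle\leq S_X$ acts transitively on $X$. A subset $Y\subseteq X$ of a quandle $(X,s)$ gives a subquandle $(Y,s|_Y)$ if $s_y(Y)=Y$ for all $y\in Y$. For a group $G$, $\operatorname{Conj} G=(G,s)$ is the quandle with $s_g(h)=ghg^{-1}$; a subquandle with underlying set $X\subseteq G$ is denoted $\operatorname{Conj} X$. A good involution of $(X,s)$ is a map $\rho:X\to X$ with $\rho^2=\mathrm{id}_X$ such that $\rho s_x=s_x\rho$ and $s_{\rho(x)}=s_x^{-1}$ for all $x$. A symmetric quandle is a pair $(R,\rho)$ with $R$ a quandle and $\rho$ a good involution of $R$. A CNS-quandle is a symmetric quandle $(R,\rho)$ such that $R$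 is connected and not involutory. *)

(* Defs.v *)
From HB Require Import structures.
From mathcomp Require Import all_boot.
From mathcomp Require Import boolp classical_sets.

Set Implicit Arguments.
Unset Strict Implicit.
Unset Printing Implicit Defensive.

Local Open Scope classical_set_scope.
Local Open Scope group_scope.

(* {perm T} requires T finite; permutations of an arbitrary type carry their
   inverse, which is determined by the underlying function (see symP). *)
Record sym (T : Type) := Sym {
  sym_fun :> T -> T;
  sym_inv : T -> T;
  sym_funK : cancel sym_fun sym_inv;
  sym_invK : cancel sym_inv sym_fun
}.

Lemma symP (T : Type) (p q : sym T) : p =1 q -> p = q.
Proof.
case: p => f f' fK f'K; case: q => g g' gK g'K /= fg.
have {}fg : f = g by apply: funext.
rewrite -{}fg in gK g'K *.
have f'g' : f' = g' by apply: funext => x; rewrite -[LHS]gK f'K.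
rewrite -{}f'g' in gK g'K *.
by congr Sym; apply: Prop_irrelevance.
Qed.

Section SymGroup.
Variable T : Type.
Implicit Types p q r : sym T.

Definition sym_one : sym T := @Sym T id id (frefl id) (frefl id).

Definition sym_mul p q : sym T :=
  @Sym T (p \o q) (sym_inv q \o sym_inv p)
    (can_comp (@sym_funK T p) (@sym_funK T q))
    (can_comp (@sym_invK T q) (@sym_invK T p)).

Definition sym_V p : sym T :=
  @Sym T (sym_inv p) p (@sym_invK T p) (@sym_funK T p).

Lemma sym_mulA : associative sym_mul. Proof. by move=> p q r; exact: symP. Qed.
Lemma sym_mul1p : left_id sym_one sym_mul.
Proof. by move=> p; exact: symP. Qed.
Lemma sym_mulp1 : right_id sym_one sym_mul.
Proof. by move=> p; exact: symP. Qed.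
Lemma sym_mulVp : left_inverse sym_one sym_V sym_mul.
Proof. by move=> p; apply: symP; exact: sym_funK. Qed.
Lemma sym_mulpV : right_inverse sym_one sym_V sym_mul.
Proof. by move=> p; apply: symP; exact: sym_invK. Qed.

HB.instance Definition _ := gen_eqMixin (sym T).
HB.instance Definition _ := gen_choiceMixin (sym T).
HB.instance Definition _ := isGroup.Build (sym T)
  sym_mulA sym_mul1p sym_mulp1 sym_mulVp sym_mulpV.

End SymGroup.

Section Groups.
Variable G : groupType.
Implicit Types (A H X : set G).

Definition generated A : set G :=
  smallest [set H | group_closed [in H]] A.

Definition center H : set G :=
  [set z | H z /\ forall h, H h -> commute z h].

Definition conjugacy_class H X : Prop :=
  exists2 h, H h & X = [set h ^ k | k in H].

Definition inversion_closed X : Prop := forall x, X x -> X x^-1.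

End Groups.

Section Racks.
Variables (T : Type) (s : T -> sym T).

Definition is_rack : Prop :=
  inhabited T /\ forall x y, s x * s y = s (s x y) * s x.

Definition is_quandle : Prop := is_rack /\ forall x, s x x = x.

Definition involutory : Prop := forall x, s x ^+ 2 = 1.

Definition rack_connected : Prop :=
  forall x y, exists2 p : sym T, generated (range s) p & p x = y.

Definition good_involution (rho : T -> T) : Prop :=
  [/\ forall x, rho (rho x) = x,
      forall x, rho \o s x = s x \o rho &
      forall x, s (rho x) = (s x)^-1].

Definition symmetric_quandle (rho : T -> T) : Prop :=
  is_quandle /\ good_involution rho.

Definition CNS_quandle (rho : T -> T) : Prop :=
  [/\ symmetric_quandle rho, rack_connected & ~ involutory].

Definition is_subquandle (Y : set T) : Prop :=
  forall y, Y y -> s y @` Y = Y.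

End Racks.

Section Restriction.
Variables (T : Type) (Y : set T).

Definition restrict (f : T -> T) (fY : forall y, Y y -> Y (f y)) : Y -> Y :=
  fun y => exist _ (f (val y)) (mem_set (fY _ (set_valP y))).

Lemma sym_stable (p : sym T) : p @` Y = Y -> forall y, Y y -> Y (p y).
Proof. by move=> pY y Yy; rewrite -pY; exists y. Qed.

Lemma sym_inv_stable (p : sym T) :
  p @` Y = Y -> forall y, Y y -> Y (sym_inv p y).
Proof. by move=> pY y; rewrite -{1}pY => -[z Yz <-]; rewrite sym_funK. Qed.

Lemma restrictK (f g : T -> T) (fY : forall y, Y y -> Y (f y))
  (gY : forall y, Y y -> Y (g y)) :
  cancel f g -> cancel (restrict fY) (restrict gY).
Proof. by move=> fK y; apply: val_inj; rewrite /= fK. Qed.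

Definition restrict_sym (p : sym T) (pY : p @` Y = Y) : sym Y :=
  @Sym Y (restrict (sym_stable pY)) (restrict (sym_inv_stable pY))
    (restrictK _ _ (@sym_funK T p)) (restrictK _ _ (@sym_invK T p)).

Definition subquandle (s : T -> sym T) (sY : is_subquandle s Y) : Y -> sym Y :=
  fun y => restrict_sym (sY _ (set_valP y)).

End Restriction.

Section Conj.
Variable G : groupType.

Lemma conj_funK (g : G) :
  cancel (fun h => g * h * g^-1) (fun h => g^-1 * h * g).
Proof. by move=> h; rewrite !mulgA mulVg mul1g -mulgA mulVg mulg1. Qed.

Lemma conj_invK (g : G) :
  cancel (fun h => g^-1 * h * g) (fun h => g * h * g^-1).
Proof. by move=> h; rewrite !mulgA mulgV mul1g -mulgA mulgV mulg1. Qed.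

(* Left conjugation; MathComp's h ^ g is g^-1 * (h * g). *)
Definition Conj (g : G) : sym G := Sym (conj_funK g) (conj_invK g).

End Conj.

(* Main.v *)
(* A product of left conjugations by elements of X is left conjugation by their
   product, so the inner group of Conj X acts on X as H does by conjugation:
   X being a class of H then says that this action is transitive.  If s_x were
   an involution, x^2 would commute with X, hence with H. *)
Require Import Defs.
From mathcomp Require Import all_boot.
From mathcomp Require Import boolp classical_sets.

Set Implicit Arguments.
Unset Strict Implicit.
Unset Printing Implicit Defensive.

Local Open Scope group_scope.

(** Bridge from the boolean membership [[in H]] inside [generated] to the propositional membership
    used below. *)
Lemma group_closed_setP (G : groupType) (H : set G) :
  group_closed [in H] <-> H 1 /\ forall x y, H x -> H y -> H (x / y).
Proof.
split=> [[H1 HV]|[H1 HV]].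
  by split=> [|x y Hx Hy]; [exact: set_mem | apply/set_mem/HV; exact: mem_set].
by split=> [|x y /set_mem Hx /set_mem Hy]; apply: mem_set => //; exact: HV.
Qed.

(** [smallest] is an intersection, and subgroups are stable under intersection. *)
Lemma generated_closed (G : groupType) (A : set G) :
  group_closed [in generated A].
Proof.
apply/group_closed_setP; split=> [|x y Ax Ay] K KA; have [KG _] := KA.
  by have /group_closed_setP[] := KG.
have /group_closed_setP[_ KV] := KG.
by apply: KV; [exact: Ax | exact: Ay].
Qed.

Lemma sub_generated (G : groupType) (A : set G) x : A x -> generated A x.
Proof. exact: sub_gen_smallest. Qed.

Lemma generated1 (G : groupType) (A : set G) : generated A 1.
Proof. by have /group_closed_setP[] := generated_closed A. Qed.

Lemma generated_div (G : groupType) (A : set G) x y :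
  generated A x -> generated A y -> generated A (x / y).
Proof. by have /group_closed_setP[_] := generated_closed A; apply. Qed.

Lemma generatedV (G : groupType) (A : set G) x :
  generated A x -> generated A x^-1.
Proof. by move=> Ax; rewrite -div1g; exact: generated_div (@generated1 G A) Ax. Qed.

Lemma generatedM (G : groupType) (A : set G) x y :
  generated A x -> generated A y -> generated A (x * y).
Proof.
move=> Ax Ay; rewrite -[y]invgK; exact: generated_div Ax (generatedV Ay).
Qed.

Lemma generated_ind (G : groupType) (A H : set G) :
    (forall x, A x -> H x) -> H 1 -> (forall x y, H x -> H y -> H (x / y)) ->
  forall x, generated A x -> H x.
Proof. by move=> AH H1 HV; apply: smallest_sub => //; apply/group_closed_setP. Qed.

(** The centralizer of [z] is a subgroup. *)
Lemma generated_commute (G : groupType) (A : set G) z :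
    (forall x, A x -> commute z x) ->
  forall x, generated A x -> commute z x.
Proof.
move=> zA; apply: (@generated_ind _ _ [set x | commute z x]%classic) => //=.
  exact: commute1.
by move=> x y zx zy; apply: commuteM => //; exact: commuteV.
Qed.

Section SubquandleOfConj.
Variables (G : groupType) (X : set G) (X_sub : is_subquandle (@Conj G) X).
Let s := subquandle X_sub.

Lemma val_subConj (x y : X) : val (s x y) = val x * val y * (val x)^-1.
Proof. by []. Qed.

Lemma subConj_quandle : inhabited X -> is_quandle s.
Proof.
move=> X0; split; first split=> // x y.
  apply: symP => z; apply: val_inj.
  by rewrite /= !invgM !invgK !mulgA !mulgVK.
by move=> x; apply: val_inj; rewrite val_subConj mulgK.
Qed.

(** Conjugation is an automorphism of [G], so it respects inverses; conjugating by an inverse undoes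
    conjugating by the element. *)
Lemma subConj_good_involution (X_inv : inversion_closed X) :
  good_involution s (restrict (f := fun g : G => g^-1) X_inv).
Proof.
split=> x.
- by apply: val_inj; rewrite /= invgK.
- by apply: funext => y; apply: val_inj; rewrite /= !invgM invgK !mulgA.
- by apply: symP => y; apply: val_inj; rewrite /= invgK.
Qed.

(** The [k] realized by some inner [p] contain [X], through [s], and form a subgroup. *)
Lemma subConj_inner (k : G) : generated X k ->
  exists2 p : sym X, generated (range s) p &
    forall x, val (p x) = k * val x * k^-1.
Proof.
apply: (@generated_ind _ _ [set k | exists2 p : sym X,
  generated (range s) p & forall x, val (p x) = k * val x * k^-1]%classic) => /=.
- move=> y Xy; exists (s (exist _ y (mem_set Xy))) => //.
  by apply: sub_generated; exists (exist _ y (mem_set Xy)).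
- exists 1; first exact: generated1.
  by move=> x; rewrite mul1g invg1 mulg1.
- move=> a b [p gp pE] [q gq qE]; exists (p / q); first exact: generated_div.
  (* [qE] describes [q] but not its inverse, so [x] is written as [q] of its preimage; the two
     conjugations by [b] then cancel. *)
  move=> x; rewrite -[x in RHS](sym_invK q) qE invgM invgK !mulgA mulgVK mulgVK.
  by rewrite -pE.
Qed.

Lemma subConj_connected :
  conjugacy_class (generated X) X -> rack_connected s.
Proof.
move=> [h _ XE] x y.
have conjE (z : X) : exists2 k, generated X k & val z = h ^ k.
  (* Stated for [g] in [G] because [X] also occurs in the type of [z]; only the hypothesis [X g] is
     to be rewritten by [XE]. *)
  have : forall g, X g -> exists2 k, generated X k & g = h ^ k.
    by move=> g; rewrite {1}XE => -[k Hk <-]; exists k.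
  by apply; exact: set_valP.
have [[k Hk xE] [l Hl yE]] := (conjE x, conjE y).
(* Left conjugation by [k] takes [x = h ^ k] back to [h], and by [l^-1] takes [h] to [h ^ l = y]. *)
have [p gp pE] := subConj_inner (generatedM (generatedV Hl) Hk).
exists p => //; apply: val_inj; rewrite pE xE yE !conjgE invgM invgK.
by rewrite !mulgA !mulgK.
Qed.

Lemma subConj_involutory (x : X) : involutory s ->
  center (generated X) (val x ^+ 2).
Proof.
move=> /(_ x) sx2; have Hx := sub_generated (set_valP x).
split; first by rewrite expgS expg1; exact: generatedM.
apply: generated_commute => y Xy.
(* In [G] this says that conjugation by the square of [val x] fixes [y]. *)
have /(congr1 val) /= : (s x ^+ 2) (exist _ y (mem_set Xy)) =
  exist _ y (mem_set Xy) by rewrite sx2.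
by rewrite /commute => {2}<-; rewrite !expgS expg0 mulg1 !mulgA !mulgVK.
Qed.

End SubquandleOfConj.

Theorem proposition9p1 (G : groupType) (X : set G)
  (X_sub : is_subquandle (@Conj G) X)
  (X_class : conjugacy_class (generated X) X)
  (X_sqr : exists2 x, X x & ~ center (generated X) (x ^+ 2))
  (X_inv : inversion_closed X) :
  CNS_quandle (subquandle X_sub) (restrict (f := fun g : G => g^-1) X_inv).
Proof.
(* [x'] serves twice: it shows [X] inhabited, and its noncentral square refutes involutivity. *)
have [x Xx x2Z] := X_sqr; pose x' : X := exist _ x (mem_set Xx).
split; first split.
- by apply: subConj_quandle; exists.
- exact: subConj_good_involution.
- exact: subConj_connected.
- by move=> /(@subConj_involutory _ _ _ x').
Qed.
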